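(* Let $m,n\geq2$ be integers, let $\mathcal{H}$ be a complex Hilbert space, and let $T\in\boldsymbol{B}(\mathcal{H})$ be a conditionally positive definite (CPD) operator such that $T^n$ is an $m$-isometry. Then $T$ is a $3$-isometry.
   Context: $\boldsymbol{B}(\mathcal{H})$ denotes the bounded linear operators on $\mathcal{H}$. For a positive integer $m$, an operator $T\in\boldsymbol{B}(\mathcal{H})$ is an $m$-isometry if $\sum_{j=0}^{m}(-1)^{m-j}\binom{m}{j}T^{*j}T^j=0$. A real sequence $\{\gamma_k\}_{k=0}^{\infty}$ is conditionally positive definite (CPD) if $\sum_{i,j=0}^{k}\gamma_{i+j}\lambda_i\bar\lambda_j\geq0$ for every integer $k\geq0$ and all $\lambda_0,\dots,\lambda_k\in\mathbb{C}$ with $\sum_{i=0}^k\lambda_i=0$. $T\in\boldsymbol{B}(\mathcal{H})$ is CPD if $\{\|T^kh\|^2\}_{k=0}^\infty$ is CPD for every $h\in\mathcal{H}$. *)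

(* Defs.v *)
From HB Require Import structures.
From mathcomp Require Import all_boot all_order all_algebra.
From mathcomp Require Import all_classical all_reals all_analysis.
From mathcomp Require Import complex ring lra.

Set Implicit Arguments.
Unset Strict Implicit.
Unset Printing Implicit Defensive.

Import Order.TTheory GRing.Theory Num.Theory.
Import numFieldNormedType.Exports.

Local Open Scope classical_set_scope.
Local Open Scope ring_scope.
Local Open Scope complex_scope.

HB.mixin Record NormedModule_hasInner (R : realType) (H : Type)
    of NormedModule R[i] H := {
  inner : H -> H -> R[i] ;
  inner_linearl : forall (y : H) (a : R[i]) (u v : H),
    inner (a *: u + v) y = a * inner u y + inner v y ;
  innerC : forall x y : H, inner y x = Num.conj (inner x y) ;
  sqr_norm_inner : forall x : H, `|x| ^+ 2 = inner x x }.

#[short(type="hilbertType")]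
HB.structure Definition Hilbert (R : realType) :=
  {H of CompleteNormedModule R[i] H & NormedModule_hasInner R H}.

Section operators.
Context {R : realType} {H : hilbertType R}.

(* The norm of [H] takes its values in [R[i]], where it is a nonnegative real. *)
Definition rnorm (x : H) : R := complex.Re `|x|.

Lemma rnormE (x : H) : (rnorm x)%:C = `|x|.
Proof. by rewrite RRe_real // normr_real. Qed.

Definition is_adjoint (T S : H -> H) :=
  forall x y, inner (T x) y = inner x (S y).

(* Meaningful for bounded linear [T], see [adjointP] and [is_adjoint_uniq]. *)
Definition adjoint (T : H -> H) : H -> H := get (is_adjoint T).

Definition m_isometry (m : nat) (T : H -> H) :=
  forall h, \sum_(j < m.+1) ((-1) ^+ (m - j) * 'C(m, j)%:R) *:
              iter j (adjoint T) (iter j T h) = 0.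

End operators.

Definition cpd_seq (R : realType) (gamma : nat -> R) :=
  forall (k : nat) (l : 'I_k.+1 -> R[i]), \sum_(i < k.+1) l i = 0 ->
    0 <= \sum_(i < k.+1) \sum_(j < k.+1)
           (gamma (i + j)%N)%:C * l i * Num.conj (l j).

Definition cpd_operator (R : realType) (H : hilbertType R) (T : H -> H) :=
  forall h, cpd_seq (fun k => rnorm (iter k T h) ^+ 2).

Section adjoint_existence.
Context {R : realType} {H : hilbertType R}.
Implicit Types x y z : H.

Let re x y : R := complex.Re (inner x y).

Let innerDl x y z : inner (x + y) z = inner x z + inner y z.
Proof. by rewrite -[x]scale1r inner_linearl mul1r scale1r. Qed.

Let inner0l x : inner 0 x = 0.
Proof. by apply: (addIr (inner 0 x)); rewrite -innerDl !add0r. Qed.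

Let innerZl (a : R[i]) x y : inner (a *: x) y = a * inner x y.
Proof. by rewrite -[a *: x]addr0 inner_linearl inner0l addr0. Qed.

Let innerNl x y : inner (- x) y = - inner x y.
Proof. by rewrite -scaleN1r innerZl mulN1r. Qed.

Let reDl x y z : re (x + y) z = re x z + re y z.
Proof. by rewrite /re innerDl raddfD. Qed.

Let rePC x y : re y x = re x y.
Proof. by rewrite /re innerC; case: (inner x y). Qed.

Let reDr x y z : re z (x + y) = re z x + re z y.
Proof. by rewrite rePC reDl !(rePC z). Qed.

Let reZl (a : R) x y : re (a%:C *: x) y = a * re x y.
Proof.
by rewrite /re innerZl; case: (inner x y) => u v /=; rewrite mul0r subr0.
Qed.

Let reZr (a : R) x y : re x (a%:C *: y) = a * re x y.
Proof. by rewrite rePC reZl rePC. Qed.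

Let reNl x y : re (- x) y = - re x y.
Proof. by rewrite /re innerNl raddfN. Qed.

Let reNr x y : re x (- y) = - re x y.
Proof. by rewrite rePC reNl rePC. Qed.

Let rexx x : re x x = rnorm x ^+ 2.
Proof.
have : (re x x)%:C = (rnorm x ^+ 2)%:C; last by case.
rewrite rmorphXn /= rnormE sqr_norm_inner.
by rewrite RRe_real // -sqr_norm_inner realX// normr_real.
Qed.

Let re_ge0 x : 0 <= re x x. Proof. by rewrite rexx sqr_ge0. Qed.

Let re_le (d : R) x y : 0 < d -> 2 * re x y <= d * re x x + d^-1 * re y y.
Proof.
move=> d0; have := re_ge0 (d%:C *: x - y).
rewrite !(reDl, reDr, reNl, reNr, reZl, reZr) (rePC x y) => h.
have {h} : 0 <= d^-1 * (d * (d * re x x) - d * re x y - d * re x y + re y y).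
  by apply: mulr_ge0; [rewrite invr_ge0 ltW | move: h; lra].
have d1 : d^-1 * d = 1 by rewrite mulVf ?gt_eqF.
have -> : d^-1 * (d * (d * re x x) - d * re x y - d * re x y + re y y) =
  (d^-1 * d) * (d * re x x) - (d^-1 * d) * re x y *+ 2 + d^-1 * re y y by ring.
rewrite d1; lra.
Qed.

(* The hypothesis says that [x |-> |x|^2 - 2 Re (f x)], which is minimal at the
   representing vector, is bounded below; every bounded [f] satisfies it. *)
Lemma riesz (f : {linear H -> R[i]^o}) (B : R) :
  (forall x, complex.Re (f x) *+ 2 <= rnorm x ^+ 2 + B) ->
  exists z, forall x, f x = inner x z.
Proof.
move=> fB.
pose J x := re x x - 2 * complex.Re (f x).
have JB x : - B <= J x by have := fB x; rewrite /J rexx; lra.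
have Jinf : has_inf (range J).
  split; first by exists (J 0), 0.
  by exists (- B) => _ [x _ <-].
pose d := inf (range J).
have dJ x : d <= J x by apply: inf_lbound; [exact: Jinf.2 | exists x].
have /choice[u uP] : forall n : nat, exists x, J x < d + n.+1%:R^-1 ^+ 2.
  move=> n; have := @inf_adherent _ (range J) (n.+1%:R^-1 ^+ 2).
  by rewrite exprn_gt0 ?invr_gt0 ?ltr0n// => /(_ isT Jinf)[_ [x _ <-] ?]; exists x.
have feD x y : complex.Re (f (x + y)) = complex.Re (f x) + complex.Re (f y) by rewrite linearD raddfD.
have feZ (a : R) x : complex.Re (f (a%:C *: x)) = a * complex.Re (f x).
  by rewrite linearZ /=; case: (f x) => p q /=; rewrite mul0r subr0.
have udist m n : (m <= n)%N -> rnorm (u m - u n) <= 2 * m.+1%:R^-1.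
  move=> mn; have em := uP m; have en := uP n.
  have e0 : 0 < m.+1%:R^-1 :> R by rewrite invr_gt0 ltr0n.
  have e1 : 0 < n.+1%:R^-1 :> R by rewrite invr_gt0 ltr0n.
  have e2 : n.+1%:R^-1 <= m.+1%:R^-1 :> R.
    by rewrite lef_pV2 ?posrE ?ltr0n// ler_nat.
  have e3 : n.+1%:R^-1 ^+ 2 <= m.+1%:R^-1 ^+ 2 :> R.
    by apply: lerXn2r => //; rewrite nnegrE ltW.
  have dm := dJ ((2^-1)%:C *: (u m + u n)).
  rewrite -[leRHS]ger0_norm; last by rewrite mulr_ge0 ?ltW.
  rewrite -[leLHS]ger0_norm; last first.
    by rewrite -ler0c rnormE normr_ge0.
  rewrite -ler_sqr ?nnegrE// !real_normK ?num_real// -rexx exprMn.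
  move: dm em en; rewrite /J feZ feD.
  rewrite !(reDl, reDr, reNl, reNr, reZl, reZr) (rePC (u m) (u n)).
  move: e3; move: (n.+1%:R^-1 ^+ 2) (m.+1%:R^-1 ^+ 2) => en em; lra.
have ucv : cvg (u @ \oo).
  apply/cauchy_cvgP/cauchy_exP => /= e e0.
  have er : (complex.Re e)%:C = e by rewrite RRe_real// gtr0_real.
  have e0' : 0 < complex.Re e by rewrite -ltcR er.
  pose N := Num.trunc (2 / complex.Re e).
  exists (u N); exists N => //= n /= Nn.
  rewrite -ball_normE /ball_/= -rnormE -er ltcR.
  apply: (le_lt_trans (udist _ _ Nn)).
  by rewrite ltr_pdivrMr ?ltr0n// mulrC -ltr_pdivrMr// truncnS_gt.
exists (lim (u @ \oo)); set z := lim _.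
have key x : complex.Re (f x) = re x z.
  suff le_key y : complex.Re (f y) <= re y z.
    apply/eqP; rewrite eq_le le_key/=.
    have := le_key (- x).
    by rewrite linearN raddfN/= reNl lerN2.
  apply/ler_addgt0Pr => e e0.
  pose c := e / (2 + re y y).
  have c20 : 0 < 2 + re y y by have := re_ge0 y; lra.
  have c0 : 0 < c by rewrite divr_gt0.
  have ce : c * (2 + re y y) = e by rewrite /c divfK// gt_eqF.
  have [n [nc nz]] : exists n : nat, n.+1%:R^-1 <= c /\ rnorm (z - u n) <= c.
    have /cvgrPdist_le /(_ c%:C) : u @ \oo --> z by [].
    rewrite ltcR => /(_ c0)[N _ NP].
    exists (maxn N (Num.trunc c^-1)); split.
      rewrite invf_ple ?posrE ?ltr0n//.
      apply/ltW/(lt_le_trans (truncnS_gt _)).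
      by rewrite ler_nat ltnS leq_maxr.
    by rewrite -lecR rnormE; apply: NP; rewrite /= leq_maxl.
  have := dJ (u n + c%:C *: y); have := uP n.
  rewrite /J feD feZ.
  rewrite !(reDl, reDr, reNl, reNr, reZl, reZr) (rePC y (u n)) => h1 h2.
  have h3 : n.+1%:R^-1 ^+ 2 <= c ^+ 2 :> R.
    by apply: lerXn2r => //; rewrite nnegrE ?invr_ge0 ?ler0n ?(ltW c0).
  have h4 : 2 * c * (complex.Re (f y) - re y (u n)) <= c * (c * (1 + re y y)).
    by move: h1 h2 h3; move: (n.+1%:R^-1 ^+ 2) => en; lra.
  have {}h4 : 2 * (complex.Re (f y) - re y (u n)) <= c * (1 + re y y).
    by rewrite -(ler_pM2l c0); move: h4; lra.
  have h5 := @re_le c y (u n - z) c0.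
  have h6 : re (u n - z) (u n - z) <= c ^+ 2.
    rewrite rexx; have -> : rnorm (u n - z) = rnorm (z - u n).
      by rewrite /rnorm distrC.
    apply: lerXn2r => //; rewrite nnegrE ?(ltW c0)//.
    by rewrite -ler0c rnormE normr_ge0.
  have h7 : c^-1 * re (u n - z) (u n - z) <= c.
    by rewrite ler_pdivrMl// -expr2.
  have h8 : 2 * (re y (u n) - re y z) <= c * re y y + c.
    by move: h5 h7; rewrite reDr reNr; lra.
  move: h4 h8 ce; lra.
move=> x; have := key x; have := key ('i *: x).
rewrite /re linearZ innerZl /=.
case: (f x) => a b; case: (inner x z) => p q /=.
by rewrite !mul0r !mul1r !sub0r => /oppr_inj -> ->.
Qed.

Lemma adjointP (T : {linear H -> H}) :
  bounded_near T (nbhs (0 : H)) -> is_adjoint T (adjoint T).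
Proof.
move=> /linear_boundedP /pinfty_ex_gt0[M M0 TM].
apply: getPex.
suff /choice[S SP] : forall y, exists z, forall x, inner (T x) y = inner x z.
  by exists S.
move=> y.
pose f : H -> R[i]^o := fun x => inner (T x) y.
have fl : linear f by move=> a u v; rewrite /f linearP inner_linearl.
pose fL := GRing.isLinear.Build R[i] H R[i]^o _ f fl.
pose f' : {linear H -> R[i]^o} := HB.pack f fL.
have Mr : (complex.Re M)%:C = M by rewrite RRe_real// gtr0_real.
have M0' : 0 < complex.Re M by rewrite -ltcR Mr.
pose m2 := complex.Re M ^+ 2.
have m20 : 0 < m2 by rewrite exprn_gt0.
apply: (@riesz f' (m2 * re y y)) => x.
rewrite -[complex.Re (f' x)]/(re (T x) y) -mulr_natl.
have := @re_le m2^-1 (T x) y; rewrite invr_gt0 invrK => /(_ m20) h.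
apply: (le_trans h); rewrite lerD2r// ler_pdivrMl// rexx -exprMn.
apply: lerXn2r; rewrite ?nnegrE.
- by rewrite -ler0c rnormE.
- by rewrite mulr_ge0 ?(ltW M0')// -ler0c rnormE.
- by rewrite -lecR rmorphM/= Mr !rnormE.
Qed.

Lemma is_adjoint_uniq (T S S' : H -> H) :
  is_adjoint T S -> is_adjoint T S' -> S = S'.
Proof.
move=> TS TS'; apply/funext => y; apply/eqP; rewrite -subr_eq0 -normr_eq0.
rewrite -sqrf_eq0 sqr_norm_inner.
have e w : inner (S y) w = inner (S' y) w by rewrite innerC -TS TS' -innerC.
by rewrite innerDl innerNl e subrr.
Qed.

End adjoint_existence.

(* Main.v *)
Require Import Defs.
From HB Require Import structures.
From mathcomp Require Import all_boot all_order all_algebra.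
From mathcomp Require Import all_classical all_reals all_analysis.
From mathcomp Require Import complex.
From mathcomp Require Import ring lra zify.

Import Order.TTheory GRing.Theory Num.Theory.
Import numFieldNormedType.Exports.

Local Open Scope ring_scope.

(** For [h] in [H] let [M_h] be the linear functional on real polynomials with
    [M_h(X^k) = |T^k h|^2], so that [M_(T h) p = M_h (X p)].  Conditional
    positive definiteness gives [M_h ((X-1)^2 q^2) >= 0], and replacing [h] by
    [T^i h] also [M_h ((X-1)^2 X^i q^2) >= 0].  The hypothesis on [T^n] makes
    [M_h] vanish on the multiples of [(X^n-1)^m].  If [2k >= m], then
    [(X^n-1)^(2k) = (X-1)^(2k) (1 + X + ... + X^(n-1))^(2k)], where the last
    factor has nonnegative coefficients and constant term 1, so
    [M_h ((X-1)^(2k)) = 0].  The Cauchy-Schwarz inequality for the positive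
    form [(p, q) |-> M_h ((X-1)^2 p q)] then lowers the exponent down to 3, and
    polarization turns [M_h ((X-1)^3) = 0] for all [h] into the claim. *)

(** * Linear functionals on real polynomials with prescribed moments *)

Section moment_functional.
Context {R : realType}.
Implicit Types (g : nat -> R) (p q : {poly R}).

Definition moment g p : R := \sum_(i < size p) p`_i * g i.

Lemma moment_widen g p N : (size p <= N)%N ->
  moment g p = \sum_(i < N) p`_i * g i.
Proof.
move=> pN; rewrite /moment (big_ord_widen N (fun i => p`_i * g i)) // big_mkcond.
apply: eq_bigr => i _; case: ltnP => // ip.
by rewrite nth_default ?mul0r.
Qed.

Lemma moment_is_linear g : linear_for *%R (moment g).
Proof.
move=> a p q; pose N := maxn (size p) (size q).
rewrite (@moment_widen g p N) ?leq_maxl // (@moment_widen g q N) ?leq_maxr //.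
rewrite (@moment_widen g _ N); last first.
  apply: (leq_trans (size_polyD _ _)).
  by rewrite geq_max leq_maxr andbT (leq_trans (size_scale_leq _ _)) ?leq_maxl.
rewrite mulr_sumr -big_split /=; apply: eq_bigr => i _.
by rewrite coefD coefZ mulrDl mulrA.
Qed.

HB.instance Definition _ g :=
  GRing.isLinear.Build R {poly R} R *%R (moment g) (moment_is_linear g).

Lemma momentXn g k : moment g 'X^k = g k.
Proof.
rewrite /moment size_polyXn big_ord_recr /= coefXn eqxx mul1r big1 ?add0r //.
by move=> i _; rewrite coefXn ltn_eqF ?mul0r.
Qed.

Lemma moment_mull g p q :
  moment g (p * q) = \sum_(i < size p) p`_i * moment g ('X^i * q).
Proof.
rewrite -{1}(coefK p) poly_def mulr_suml linear_sum /=.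
by apply: eq_bigr => i _; rewrite -scalerAl linearZ.
Qed.

Lemma moment_mul g p q :
  moment g (p * q) =
  \sum_(i < size p) \sum_(j < size q) g (i + j)%N * p`_i * q`_j.
Proof.
rewrite moment_mull; apply: eq_bigr => i _.
rewrite (mulrC _ q) moment_mull mulr_sumr; apply: eq_bigr => j _.
by rewrite -exprD momentXn addnC; ring.
Qed.

(** For the norm sequence of an operator and [n = 1], the sum is the quadratic form of its
    [m]-isometry defect; for general [n], that of its [n]-th power. *)
Lemma moment_exp_sub1 g n m :
  moment g (('X^n - 1) ^+ m) =
  \sum_(j < m.+1) (-1) ^+ (m - j) * 'C(m, j)%:R * g (n * j)%N.
Proof.
rewrite addrC exprDn linear_sum /=; apply: eq_bigr => j _.
rewrite -exprM raddfMn /= -polyCN -polyC_exp mul_polyC linearZ /= momentXn.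
by rewrite -mulr_natr; ring.
Qed.

(** The coefficients of [q = ('X - 1) * p] sum to [q.[1] = 0], so they are admissible weights in
    [cpd_seq]. *)
Lemma cpd_seq_moment_ge0 g p : cpd_seq g ->
  0 <= moment g (('X - 1) ^+ 2 * p ^+ 2).
Proof.
move=> gcpd; rewrite -exprMn expr2; set q := ('X - 1) * p.
(* [cpd_seq] takes [k.+1] weights, so [size q] has to be positive. *)
have [-> | q0] := eqVneq q 0; first by rewrite mul0r linear0.
have sq : size q = (size q).-1.+1 by rewrite prednK // size_poly_gt0.
have q1 : q.[1] = 0 by rewrite /q hornerM !hornerE subrr mul0r.
have := gcpd (size q).-1 (fun i => (q`_i)%:C%C).
rewrite -rmorph_sum /= -sq => /(_ _)/wrap[].
  congr (_%:C%C); rewrite -[RHS]q1 horner_coef.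
  by apply: eq_bigr => i _; rewrite expr1n mulr1.
suff -> : \sum_(i < size q) \sum_(j < size q)
     (g (i + j)%N)%:C%C * (q`_i)%:C%C * Num.conj (q`_j)%:C%C
    = (moment g (q * q))%:C%C by rewrite ler0c.
rewrite moment_mul rmorph_sum /=; apply: eq_bigr => i _.
rewrite rmorph_sum /=; apply: eq_bigr => j _.
by rewrite !rmorphM /=; congr (_ * _); exact: conjc_real.
Qed.

End moment_functional.

(** If [a] were nonzero, the linear term would dominate for small [t] of the opposite sign. *)
Lemma quadratic_ge0_slope0 {R : realFieldType} (a b : R) :
  (forall t, 0 <= t * a + t ^+ 2 * b) -> a = 0.
Proof.
move=> ab; apply/eqP/negPn/negP => a0.
have c0 : 0 < 1 + `|b| by rewrite ltr_pwDl.
(* At this [t] the value is [- t^2 (1 + |b| - b)]; the added 1 makes both the denominator and the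
   last factor positive. *)
have := ab (- a / (1 + `|b|)).
have -> : - a / (1 + `|b|) * a + (- a / (1 + `|b|)) ^+ 2 * b =
   - (a / (1 + `|b|)) ^+ 2 * (1 + `|b| - b).
  by field; rewrite gt_eqF.
rewrite mulNr oppr_ge0 leNgt mulr_gt0 //.
  by rewrite exprn_even_gt0 //= mulf_neq0 // invr_eq0 gt_eqF.
by have := ler_norm b; lra.
Qed.

(** * Families of conditionally positive definite sequences closed under the shift *)

Section positive_family.
Context {R : realType} {V : Type} (f : V -> V) (g : V -> nat -> R).
Hypothesis g_shift : forall v k, g (f v) k = g v k.+1.
Hypothesis g_cpd : forall v, cpd_seq (g v).
Implicit Types (v : V) (p q : {poly R}).

Lemma moment_mulXn v k p :
  moment (g v) ('X^k * p) = moment (g (iter k f v)) p.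
Proof.
have giter j : g (iter k f v) j = g v (k + j)%N.
  by elim: k j => //= k IHk j; rewrite g_shift IHk addSnnS.
rewrite mulrC moment_mull; apply: eq_bigr => i _.
by rewrite -exprD momentXn addnC -giter.
Qed.

(** Multiplying by ['X^i] replaces [v] by an iterate, so the polynomials killed at every [v] form an
    ideal. *)
Lemma moment_eq0_mulr p : (forall v, moment (g v) p = 0) ->
  forall v q, moment (g v) (p * q) = 0.
Proof.
move=> p0 v q; rewrite mulrC moment_mull big1 // => i _.
by rewrite moment_mulXn p0 mulr0.
Qed.

(** Positivity at [p + t *: q] gives a quadratic in [t] without constant term, whose slope at 0 must
    vanish. *)
Lemma moment_cauchy_schwarz v p q :
  moment (g v) (('X - 1) ^+ 2 * p ^+ 2) = 0 ->
  moment (g v) (('X - 1) ^+ 2 * (p * q)) = 0.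
Proof.
move=> p0; suff /eqP : moment (g v) (('X - 1) ^+ 2 * (p * q)) *+ 2 = 0.
  by rewrite mulrn_eq0 => /eqP.
apply: (@quadratic_ge0_slope0 _ _ (moment (g v) (('X - 1) ^+ 2 * q ^+ 2))) => t.
have := cpd_seq_moment_ge0 (g v) (p + t *: q) (g_cpd v).
have -> : ('X - 1) ^+ 2 * (p + t *: q) ^+ 2 = ('X - 1) ^+ 2 * p ^+ 2 +
    ((t * 2) *: (('X - 1) ^+ 2 * (p * q)) + (t ^+ 2) *: (('X - 1) ^+ 2 * q ^+ 2)).
  by rewrite -!mul_polyC polyC_exp polyCM polyC_natr; ring.
by rewrite !linearD /= p0 add0r !linearZ /= -mulrA mulr_natl.
Qed.

(** Cauchy-Schwarz for [(X - 1)^(e - 2)] and 1 lowers the exponent from [e + 1] to [e] as long as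
    [2 + 2 (e - 2) >= e + 1], that is, [e >= 3]. *)
Lemma moment_exp_descent j :
  (forall v, moment (g v) (('X - 1) ^+ (3 + j)) = 0) ->
  forall v, moment (g v) (('X - 1) ^+ 3) = 0.
Proof.
elim: j => [//|j IHj] gj; apply: IHj => v.
have -> : ('X - 1) ^+ (3 + j) = ('X - 1) ^+ 2 * (('X - 1) ^+ j.+1 * 1)
    :> {poly R} by rewrite mulr1 -exprD; congr (_ ^+ _); lia.
apply: moment_cauchy_schwarz.
have -> : ('X - 1) ^+ 2 * (('X - 1) ^+ j.+1) ^+ 2 =
    ('X - 1) ^+ (3 + j.+1) * ('X - 1) ^+ j :> {poly R}.
  by rewrite -exprM -!exprD; congr (_ ^+ _); lia.
exact: moment_eq0_mulr.
Qed.

Lemma moment_even_exp_eq0 n k : (0 < n)%N -> (0 < k)%N ->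
  (forall v, moment (g v) (('X^n - 1) ^+ (2 * k)) = 0) ->
  forall v, moment (g v) (('X - 1) ^+ (2 * k)) = 0.
Proof.
move=> n0 k0 gn v.
pose S : {poly R} := (\sum_(i < n) 'X^i) ^+ (2 * k).
have XS : ('X^n - 1) ^+ (2 * k) = S * ('X - 1) ^+ (2 * k).
  by rewrite subrX1 exprMn mulrC.
have S_ge0 i : 0 <= S`_i.
  rewrite /S; elim: (2 * k)%N i => [|e IHe] i.
    by rewrite expr0 coef1 ler0n.
  rewrite exprS coefM sumr_ge0 // => j _; apply: mulr_ge0 => //.
  by rewrite coef_sum sumr_ge0 // => l _; rewrite coefXn ler0n.
have S0 : S`_0 = 1.
  rewrite -horner_coef0 /S horner_exp horner_sum.
  case: n n0 {gn S XS S_ge0} => // n _; rewrite big_ord_recl /= big1 ?addr0.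
    by rewrite expr0 hornerC expr1n.
  by move=> i _; rewrite hornerXn expr0n.
(* The even exponent makes the polynomial [(X - 1)^2] times a square. *)
have pos w : 0 <= moment (g w) (('X - 1) ^+ (2 * k)).
  have -> : ('X - 1) ^+ (2 * k) = ('X - 1) ^+ 2 * (('X - 1) ^+ k.-1) ^+ 2
      :> {poly R} by rewrite -exprM -exprD; congr (_ ^+ _); lia.
  exact: cpd_seq_moment_ge0.
have sS : (0 < size S)%N.
  by rewrite size_poly_gt0; apply/eqP => E; move: S0; rewrite E coef0; lra.
have := gn v; rewrite XS moment_mull => /eqP.
(* Nonnegative terms with sum 0 all vanish; the term of index 0 is the moment sought, as [S] has
   constant term 1. *)
rewrite psumr_eq0 => [/allP/(_ (Ordinal sS))|i _]; last first.
  by rewrite mulr_ge0 // moment_mulXn.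
by rewrite mem_index_enum /= S0 mul1r expr0 mul1r => /(_ isT) /eqP.
Qed.

Lemma moment_sub1_cube_eq0 n m : (0 < n)%N ->
  (forall v, moment (g v) (('X^n - 1) ^+ m) = 0) ->
  forall v, moment (g v) (('X - 1) ^+ 3) = 0.
Proof.
(* This choice makes the exponent [3 + (2 * m + 1) = 2 * (m + 2)] even and at least [m]. *)
move=> n0 gm; apply: (@moment_exp_descent (2 * m + 1)).
rewrite (_ : 3 + (2 * m + 1) = 2 * m.+2)%N; last by lia.
apply: (moment_even_exp_eq0 n) => // v.
rewrite (_ : 2 * m.+2 = m + (m + 4))%N; last by lia.
by rewrite exprD; apply: moment_eq0_mulr.
Qed.

End positive_family.

(** * Adjoints, polarization and [m]-isometries *)

Section hilbert_operators.
Context {R : realType} {H : hilbertType R}.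
Implicit Types (x y z : H) (T S : H -> H).

Lemma innerDl x y z : inner (x + y) z = inner x z + inner y z.
Proof. by rewrite -[x]scale1r inner_linearl mul1r scale1r. Qed.

Lemma inner0l x : inner (0 : H) x = 0.
Proof. by apply: (addIr (inner 0 x)); rewrite -innerDl !add0r. Qed.

Lemma innerZl (a : R[i]) x y : inner (a *: x) y = a * inner x y.
Proof. by rewrite -[a *: x]addr0 inner_linearl inner0l addr0. Qed.

Lemma innerDr x y z : inner z (x + y) = inner z x + inner z y.
Proof. by rewrite innerC innerDl rmorphD /= -!innerC. Qed.

Lemma innerZr (a : R[i]) x y : inner x (a *: y) = Num.conj a * inner x y.
Proof. by rewrite innerC innerZl rmorphM /= -innerC. Qed.

Lemma inner_suml (I : finType) (F : I -> H) y :
  inner (\sum_i F i) y = \sum_i inner (F i) y.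
Proof.
by apply: (big_morph (fun x => inner x y)) => [u v|]; rewrite ?innerDl ?inner0l.
Qed.

Lemma inner_eq0 x : inner x x = 0 -> x = 0.
Proof.
by move=> /eqP; rewrite -sqr_norm_inner sqrf_eq0 normr_eq0 => /eqP.
Qed.

Lemma is_adjointC {T S} : is_adjoint T S -> is_adjoint S T.
Proof. by move=> TS x y; rewrite innerC -TS -innerC. Qed.

Lemma is_adjoint_iter {T S} k :
  is_adjoint T S -> is_adjoint (iter k T) (iter k S).
Proof. by move=> TS; elim: k => //= k IHk x y; rewrite TS IHk -iterSr. Qed.

(** Any [S] makes the choice in [adjoint] succeed; for [iter n T] an iterate of the adjoint of [T]
    serves. *)
Lemma adjoint_is_adjoint {T S} : is_adjoint T S -> is_adjoint T (adjoint T).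
Proof. by move=> TS; apply: getPex; exists S. Qed.

Definition norm_seq T x (k : nat) : R := rnorm (iter k T x) ^+ 2.

Lemma norm_seq_inner T x k :
  (norm_seq T x k)%:C%C = inner (iter k T x) (iter k T x).
Proof. by rewrite rmorphXn /= rnormE sqr_norm_inner. Qed.

Definition isometry_defect m T x : H :=
  \sum_(j < m.+1) ((-1) ^+ (m - j) * 'C(m, j)%:R) *:
              iter j (adjoint T) (iter j T x).

Lemma inner_isometry_defect {T S} m x y : is_adjoint T S ->
  inner (isometry_defect m T x) y =
  \sum_(j < m.+1) ((-1) ^+ (m - j) * 'C(m, j)%:R) *
    inner (iter j T x) (iter j T y).
Proof.
move=> /adjoint_is_adjoint/is_adjointC TS.
rewrite inner_suml; apply: eq_bigr => j _.
by rewrite innerZl (is_adjoint_iter j TS).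
Qed.

Lemma inner_isometry_defect_diag {T S} m x : is_adjoint T S ->
  inner (isometry_defect m T x) x =
  (moment (norm_seq T x) (('X - 1) ^+ m))%:C%C.
Proof.
move=> TS; rewrite (inner_isometry_defect m x x TS) -(expr1 'X).
rewrite moment_exp_sub1 rmorph_sum /=; apply: eq_bigr => j _.
by rewrite mul1n 2!rmorphM /= norm_seq_inner rmorphXn rmorphN1 rmorph_nat.
Qed.

Lemma sesquilinear_eq0 (a : H -> H -> R[i]) :
  (forall x y z, a (x + y) z = a x z + a y z) ->
  (forall x y z, a z (x + y) = a z x + a z y) ->
  (forall c x y, a (c *: x) y = c * a x y) ->
  (forall c x y, a x (c *: y) = Num.conj c * a x y) ->
  (forall x, a x x = 0) -> forall x y, a x y = 0.
Proof.
move=> aDl aDr aZl aZr axx x y.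
have asym u v : a u v = - a v u.
  apply/eqP; rewrite -addr_eq0; apply/eqP.
  by have := axx (u + v); rewrite aDl !aDr !axx add0r addr0.
(* Antisymmetry and conjugate linearity give [i a(x, y) = conj(i) a(x, y)], and [i] differs from its
   conjugate. *)
have := asym ('i%C *: x) y.
rewrite aZl aZr (asym y x) mulrN opprK => /eqP.
rewrite -subr_eq0 -mulrBl mulf_eq0 => /orP[|/eqP //].
rewrite eq_complex /= => /andP[_].
by rewrite opprK -(natrD _ 1 1) pnatr_eq0.
Qed.

Lemma m_isometryP (T : {linear H -> H}) S m : is_adjoint T S ->
  m_isometry m T <-> forall x, moment (norm_seq T x) (('X - 1) ^+ m) = 0.
Proof.
move=> TS; split=> [Tm x|T0 x].
  have := inner_isometry_defect_diag m x TS.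
  by rewrite [isometry_defect _ _ _]Tm inner0l => -[].
apply: inner_eq0; rewrite -/(isometry_defect m T x).
have itD k u v : iter k T (u + v) = iter k T u + iter k T v.
  by elim: k => //= k ->; rewrite linearD.
have itZ k c u : iter k T (c *: u) = c *: iter k T u.
  by elim: k => //= k ->; rewrite linearZ.
(* Freeing the second argument turns the goal into the vanishing of a sesquilinear form, known on
   the diagonal. *)
move: {2}(isometry_defect m T x) => y.
apply: (@sesquilinear_eq0 (fun u v => inner (isometry_defect m T u) v)).
- move=> u v w; rewrite !(inner_isometry_defect _ _ _ TS) -big_split /=.
  by apply: eq_bigr => j _; rewrite itD innerDl mulrDr.
- by move=> u v w; rewrite innerDr.
- move=> c u v; rewrite !(inner_isometry_defect _ _ _ TS) mulr_sumr.
  by apply: eq_bigr => j _; rewrite itZ innerZl mulrCA.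
- by move=> c u v; rewrite innerZr.
- by move=> u; rewrite (inner_isometry_defect_diag _ _ TS) T0.
Qed.

End hilbert_operators.

Theorem theorem5p2 (R : realType) (m n : nat) (hm : (2 <= m)%N) (hn : (2 <= n)%N)
    (H : hilbertType R) (T : {linear H -> H})
    (hT : bounded_near T (nbhs (0 : H)))
    (hcpd : cpd_operator T) (hiso : m_isometry m (iter n T)) :
  m_isometry 3 T.
Proof.
have TS := adjointP hT.
apply/(m_isometryP _ _ _ TS).
apply: (@moment_sub1_cube_eq0 _ _ T (norm_seq T) _ hcpd n m).
- by move=> x k; rewrite /norm_seq -iterSr.
- exact: leq_trans hn.
(* Since [(T^n)^j = T^(n j)], the moment of [(X - 1)^m] for [T^n] is that of [(X^n - 1)^m] for
   [T]. *)
move=> x; have := inner_isometry_defect_diag m x (is_adjoint_iter n TS).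
rewrite [isometry_defect _ _ _]hiso inner0l => -[E].
rewrite [RHS]E moment_exp_sub1 -(expr1 'X) moment_exp_sub1; apply: eq_bigr => j _.
by rewrite /norm_seq mul1n mulnC iterM.
Qed.
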